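(* Let $k,\ell\ge 0$ be integers with $k+\ell\ge 1$ and let $\beta>0$ be a real number. For each $1\le p\le k$, $$\lambda^{(\beta;k,\ell)}_{p,E}(n)\sim\frac{n}{k+\ell}\quad (n\to\infty),\qquad\text{namely}\qquad \lim_{n\to\infty}\frac{\lambda^{(\beta;k,\ell)}_{p,E}(n)}{n/(k+\ell)}=1.$$ Similarly, for each $1\le q\le \ell$, $$\lambda'^{(\beta;k,\ell)}_{q,E}(n)\sim\frac{n}{k+\ell}\quad (n\to\infty).$$
   Context: For a partition $\lambda=(\lambda_1,\lambda_2,\ldots)$ of $n$ (written $\lambda\vdash n$, with $\lambda_i=0$ for $i$ larger than the number of parts), $\lambda'=(\lambda'_1,\lambda'_2,\ldots)$ denotes the conjugate partition (so $\lambda_p$ is the length of the $p$-th row and $\lambda'_q$ the length of the $q$-th column of the Young diagram), and $f^\lambda$ denotes the number of standard Young tableaux of shape $\lambda$. For integers $k,\ell\ge 0$, $H(k,\ell;n)=\{\lambda\vdash n\mid \lambda_{k+1}\le \ell\}$. For $\beta>0$, $1\le p\le k$ and $1\le q\le\ell$ the expected length of the $p$-th row and of the $q$-th column are $$\lambda^{(\beta;k,\ell)}_{p,E}(n)=\frac{\sum_{\lambda\in H(k,\ell;n)}\lambda_{p}\,(f^\lambda)^{\beta}}{\sum_{\lambda\in H(k,\ell;n)}(f^\lambda)^{\beta}},\qquad \lambda'^{(\beta;k,\ell)}_{q,E}(n)=\frac{\sum_{\lambda\in H(k,\ell;n)}\lambda'_{q}\,(f^\lambda)^{\beta}}{\sum_{\lambda\in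 H(k,\ell;n)}(f^\lambda)^{\beta}}.$$ For real sequences with $b_n\neq 0$ for large $n$, $a_n\sim b_n$ means $\lim_{n\to\infty}a_n/b_n=1$. *)

(* Defs.v *)
From HB Require Import structures.
From mathcomp Require Import all_boot all_order all_algebra.
From mathcomp Require Import all_classical all_reals all_analysis.

Set Implicit Arguments.
Unset Strict Implicit.
Unset Printing Implicit Defensive.

Import Order.TTheory GRing.Theory Num.Theory.

Section Partitions.
Local Open Scope nat_scope.
Variable n : nat.

(* A partition of n has at most n parts, each at most n; it is stored as its
   first n parts, padded with zeros, so that partitions form a finite type. *)
Definition is_intpart (t : n.-tuple 'I_n.+1) : bool :=
  sorted geq (map val t) && (sumn (map val t) == n).

Definition intpart := {t : n.-tuple 'I_n.+1 | is_intpart t}.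

Implicit Type la : intpart.

(* 1-based, as in lambda_1 >= lambda_2 >= ...; zero for p > n. The value at
   p = 0 is meaningless. *)
Definition row_len la (p : nat) : nat := nth 0 (map val (val la)) p.-1.

(* Young diagram, with cells (row, column) numbered from 0. *)
Definition in_diagram la (c : 'I_n * 'I_n) : bool := c.2 < row_len la c.1.+1.

(* The q-th part of the conjugate partition (1-based): the number of rows
   of length at least q. The value at q = 0 is meaningless. *)
Definition col_len la (q : nat) : nat :=
  #|[pred i : 'I_n | q <= row_len la i.+1]|.

Definition cell la := {c : 'I_n * 'I_n | in_diagram la c}.

(* Entries are 0, ..., n-1 instead of 1, ..., n. Since the diagram has exactly
   n cells (card_cell), injectivity says that every entry occurs once. *)
Definition is_syt la (T : {ffun cell la -> 'I_n}) : bool :=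
  [&& injectiveb T,
      [forall c : cell la, forall d : cell la,
        ((val c).1 == (val d).1) && ((val c).2 < (val d).2) ==> (T c < T d)]
    & [forall c : cell la, forall d : cell la,
        ((val c).2 == (val d).2) && ((val c).1 < (val d).1) ==> (T c < T d)]].

Definition num_syt la : nat := #|[pred T : {ffun cell la -> 'I_n} | is_syt T]|.

Lemma row_len_leq la p : row_len la p <= n.
Proof.
rewrite /row_len; set t := val la.
case: (ltnP p.-1 (size t)) => h; last by rewrite nth_default ?size_map.
by rewrite (nth_map ord0) // -ltnS ltn_ord.
Qed.

Lemma card_cell la : #|{: cell la}| = n.
Proof.
rewrite card_sig -sum1_card (eq_bigl (in_diagram la)) //.
rewrite -(pair_big_dep xpredT (fun i j => in_diagram la (i, j))
            (fun _ _ => 1)) /=.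
transitivity (\sum_(i < n) row_len la i.+1).
  apply: eq_bigr => i _.
  rewrite -(big_ord_widen n (fun=> 1) (row_len_leq la i.+1)).
  by rewrite sum1_card card_ord.
have /andP[_ /eqP] := valP la; apply: etrans.
by rewrite sumnE (big_nth 0) big_mkord size_map size_tuple.
Qed.

End Partitions.

Definition hook (k l n : nat) : {set intpart n} :=
  [set la : intpart n | (row_len la k.+1 <= l)%N]%SET.

Section Expectations.
Local Open Scope ring_scope.
Variables (R : realType) (beta : R) (k l : nat).

Definition expected_row (p n : nat) : R :=
  (\sum_(la in hook k l n) (row_len la p)%:R * (num_syt la)%:R `^ beta) /
  (\sum_(la in hook k l n) (num_syt la)%:R `^ beta).

Definition expected_col (q n : nat) : R :=
  (\sum_(la in hook k l n) (col_len la q)%:R * (num_syt la)%:R `^ beta) /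
  (\sum_(la in hook k l n) (num_syt la)%:R `^ beta).

End Expectations.

(* Main.v *)
Require Import Defs.
From mathcomp Require Import all_boot all_order all_algebra.
From mathcomp Require Import all_classical all_reals all_analysis.
From mathcomp Require Import zify ring lra.
Import Order.TTheory GRing.Theory Num.Theory numFieldNormedType.Exports.
Local Open Scope classical_set_scope.
Local Open Scope ring_scope.

(** Write d = k + l and F(la) for the number of standard tableaux of shape la.

    A partition in the (k, l) hook is cut into d arms: its first k rows, and
    what remains of its first l columns below these rows.  Listing the arms
    that receive the successive entries turns a standard tableau into a word
    of length n over d letters, and the tableau can be recovered from its word
    ([word_of_inj]).  The number of occurrences of a letter is the length a_p
    of its arm.  Giving the letter p the weight x and the others the weight 1,
    and summing over all words, yields [num_syt_arm]:
    F(la) * x ^ a_p(la) <= (d - 1 + x) ^ n for every x >= 0.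

    Conversely some shape of the hook has d ^ n tableaux up to a factor that is
    polynomial in n ([num_syt_lower]).  A word gives a tableau as soon as its
    letter counts stay suitably ordered along all prefixes.  Words whose counts
    stay strictly decreasing are walks in a Weyl chamber, and the product of
    the differences of the coordinates is discrete harmonic on that chamber
    and vanishes on its walls.  Hence the sum of this product over the
    endpoints of the walks of length N is exactly d ^ N times its value at the
    start ([sum_walks]); as the product is polynomially bounded, there are
    about d ^ N walks.  They have polynomially many endpoints, so that one of
    these endpoints, that is one shape, is reached by many walks.

    Let E be the mean of a_p under the weights F ^ beta.  With x = exp s, the
    upper bound controls the mean of exp (s beta a_p), because the hook has
    polynomially many shapes ([card_hook]) and the total weight is at least
    the weight of the richest shape.  Jensen's inequality ([expR_mean]) then
    gives
      s E <= n ln (1 + (exp s - 1) / d) + O(ln n)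
          <= (s + 2 s ^ 2) n / d + O(ln n)
    for s <= 1/2 ([mean_tilt]).  A small positive s bounds E from above and a
    small negative one from below, whence E ~ n / d.  Rows are arms, and a
    column differs from its arm by at most k. *)

(** * Hook shapes and their arms *)

Section Shapes.
Local Open Scope nat_scope.
Variable n : nat.
Implicit Type la : intpart n.

Lemma row_len_anti la i j : i <= j -> row_len la j.+1 <= row_len la i.+1.
Proof.
move=> ij; rewrite /row_len /=; have /andP[srt _] := valP la.
set s := map _ _ in srt *; case: (ltnP j (size s)) => js; last by rewrite (nth_default 0 js).
apply: (sorted_leq_nth (leT := geq)) => //.
- by move=> x y z /= yx xz; apply: leq_trans xz yx.
- by move=> x /=.
- by rewrite inE; apply: leq_ltn_trans js.
Qed.

(** Row lengths decrease, so the rows of length at least q are the first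
    ones; here rows are numbered from 0. *)
Lemma lt_col_len la q (i : 'I_n) : (i < col_len la q) = (q <= row_len la i.+1).
Proof.
rewrite /col_len; apply/idP/idP => [|qi].
  apply: contraTT; rewrite -ltnNge -leqNgt => iq.
  have -> : val i = #|[pred j : 'I_n | j < i]|.
    rewrite -sum1_card -(big_ord_widen n (fun=> 1)) 1?ltnW //.
    by rewrite sum1_card card_ord.
  apply/subset_leq_card/fintype.subsetP => j; rewrite !inE => qj.
  rewrite ltnNge; apply: contraL qj => ij; rewrite -ltnNge.
  exact: leq_ltn_trans (row_len_anti _ _ _ ij) iq.
have -> : i.+1 = #|[pred j : 'I_n | j < i.+1]|.
  rewrite -sum1_card -(big_ord_widen n (fun=> 1)) //.
  by rewrite sum1_card card_ord.
apply/subset_leq_card/fintype.subsetP => j; rewrite !inE => ji.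
exact: leq_trans qi (row_len_anti _ _ _ (ji : j <= i)).
Qed.

Lemma col_len_leq la q : col_len la q <= n.
Proof. by rewrite -[leqRHS]card_ord max_card. Qed.

Lemma intpart_eq la mu :
  (forall i : 'I_n, row_len la i.+1 = row_len mu i.+1) -> la = mu.
Proof.
move=> E; apply/val_inj/eq_from_tnth => i; apply/val_inj.
have := E i; rewrite /row_len /=.
by rewrite !(nth_map (tnth (val la) i)) ?size_tuple // -!tnth_nth.
Qed.

Variables k l : nat.

(** A shape of the hook is determined by its first k rows and its first l
    columns: a lower row has length at most l, and its length is read off from
    these columns. *)
Lemma card_hook : #|hook k l n| <= n.+1 ^ (k + l).
Proof.
pose f la : {ffun 'I_k -> 'I_n.+1} * {ffun 'I_l -> 'I_n.+1} :=
  ([ffun p : 'I_k => inord (row_len la p.+1)],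
   [ffun q : 'I_l => inord (col_len la q.+1)]).
have f_inj : {in hook k l n &, injective f}.
  move=> la mu; rewrite !inE => hla hmu [/ffunP Er /ffunP Ec].
  have {}Er (i : 'I_n) : i < k -> row_len la i.+1 = row_len mu i.+1.
    move=> ik; have := congr1 val (Er (Ordinal ik)).
    by rewrite !ffunE /= !inordK // ltnS row_len_leq.
  have {}Ec q : q < l -> col_len la q.+1 = col_len mu q.+1.
    move=> ql; have := congr1 val (Ec (Ordinal ql)).
    by rewrite !ffunE /= !inordK // ltnS col_len_leq.
  apply: intpart_eq => i; case: (ltnP i k) => ik; first exact: Er.
  have {}hla := leq_trans (row_len_anti la _ _ ik) hla.
  have {}hmu := leq_trans (row_len_anti mu _ _ ik) hmu.
  have key q : q <= l -> (q <= row_len la i.+1) = (q <= row_len mu i.+1).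
    by case: q => // q ql; rewrite -!lt_col_len Ec.
  by apply/eqP; rewrite eqn_leq -key // leqnn /= key // leqnn.
rewrite -(card_in_imset f_inj).
apply: leq_trans (max_card _) _.
by rewrite card_prod !card_ffun !card_ord expnD.
Qed.

(** The index of the arm of a cell: rows are numbered from 0 to k - 1, the
    columns below them from k on. *)
Definition letter (c : 'I_n * 'I_n) : nat := if c.1 < k then c.1 : nat else k + c.2.
Definition arm la j : nat := #|[pred c : cell la | letter (val c) == j]|.

Lemma letter_hook la (c : cell la) : la \in hook k l n -> letter (val c) < k + l.
Proof.
rewrite inE /letter => hla; case: (ltnP _ k) => [|kc]; first exact: ltn_addr.
rewrite ltn_add2l; apply: leq_trans (valP c) _.
exact: leq_trans (row_len_anti la _ _ kc) hla.
Qed.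

Lemma armE la j : arm la j = #|[pred c | in_diagram la c & letter c == j]|.
Proof.
rewrite /arm -(fintype.card_image val_inj); apply: fintype.eq_card => c; rewrite inE /=.
apply/fintype.imageP/andP => [[x xj ->]|[cla cj]]; first by rewrite (valP x).
by exists (Sub c cla).
Qed.

Lemma arm_row la p : p < k -> arm la p = row_len la p.+1.
Proof.
move=> pk; rewrite armE; case: (ltnP p n) => [pn|np]; last first.
  rewrite /row_len nth_default ?size_map ?size_tuple //=; apply: eq_card0 => -[i x].
  rewrite inE /letter /=; apply/andP => -[_]; have := ltn_ord i.
  by case: ifP => ck c1 /eqP cp; lia.
have -> : row_len la p.+1 = #|[pred x : 'I_n | x < row_len la p.+1]|.
  by rewrite -sum1_card -(big_ord_widen n (fun=> 1)) ?row_len_leq // sum1_card card_ord.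
rewrite -(@fintype.card_image _ _ (fun x : 'I_n => (Ordinal pn, x))); last by move=> x y [].
apply: fintype.eq_card => -[i x]; rewrite inE /letter /in_diagram /=.
apply/andP/fintype.imageP => [[ix]|[y] yp [-> ->]]; last by rewrite pk eqxx.
case: ifP => ik /eqP ip; last by lia.
by exists x; [rewrite inE -ip | congr (_, _); apply/val_inj].
Qed.

(** The arm of a column lacks the cells that lie in the first k rows. *)
Lemma arm_col la q : col_len la q.+1 - k <= arm la (k + q) <= col_len la q.+1.
Proof.
case: (ltnP q n) => [qn|nq]; last first.
  have -> : col_len la q.+1 = 0.
    by apply: eq_card0 => i; rewrite !inE; have := row_len_leq la i.+1; lia.
  rewrite sub0n /= armE leqn0; apply/eqP/eq_card0 => -[i x].
  rewrite inE /letter /=; apply/andP => -[_]; have := ltn_ord x.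
  by case: ifP => ck c1 /eqP cp; lia.
have -> : arm la (k + q) = #|[pred i : 'I_n | (k <= i) && (q < row_len la i.+1)]|.
  rewrite armE -(@fintype.card_image _ _ (fun i : 'I_n => (i, Ordinal qn))); last by move=> x y [].
  apply: fintype.eq_card => -[i x]; rewrite inE /letter /in_diagram /=.
  apply/andP/fintype.imageP => [[ix]|[y] yp [-> ->]] /=; last first.
    by move: yp; rewrite inE => /andP[ky ->]; rewrite ltnNge ky /= eqxx.
  case: ifP => ik /eqP ip; first by lia.
  have xq : x = Ordinal qn by apply/val_inj => /=; lia.
  by exists i; rewrite -?xq // inE leqNgt ik; rewrite xq in ix.
rewrite /col_len; apply/andP; split; last first.
  by apply/subset_leq_card/fintype.subsetP => i; rewrite !inE => /andP[].
have fP (i : 'I_(col_len la q.+1 - k)) : k + i < n.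
  by have := ltn_ord i; have := col_len_leq la q.+1; lia.
rewrite -[leqLHS]card_ord -(@fintype.card_image _ _ (fun i => Ordinal (fP i))); last first.
  by move=> i j [/addnI /val_inj].
apply/subset_leq_card/fintype.subsetP => _ /fintype.imageP[i _ ->].
by rewrite inE leq_addr -(lt_col_len la q.+1) /=; have := ltn_ord i; lia.
Qed.

(** * Tableaux as words: the upper bound *)

Section UpperBound.
Variable la : intpart n.
Hypothesis hla : la \in hook k l n.

(** Inside an arm only one coordinate varies, so that the sum of the two
    coordinates orders the cells of a row arm and of a column arm alike. *)
Lemma syt_mono (T : {ffun cell la -> 'I_n}) (c e : cell la) :
  is_syt T -> letter (val c) = letter (val e) -> c != e ->
  (T c < T e) = ((val c).1 + (val c).2 < (val e).1 + (val e).2).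
Proof.
case/and3P=> _ /forallP rowT /forallP colT.
have mono (x y : cell la) : letter (val x) = letter (val y) ->
    (val x).1 + (val x).2 < (val y).1 + (val y).2 -> T x < T y.
  rewrite /letter; have := forallP (rowT x) y; have := forallP (colT x) y.
  rewrite -!val_eqE /= => /implyP hcol /implyP hrow.
  by case: ltnP => xk; case: ltnP => yk xy lt;
    [apply: hrow | lia | lia | apply: hcol]; lia.
move=> ce ne; apply/idP/idP; last exact: mono.
apply: contraTT; rewrite -!leqNgt leq_eqVlt => /orP[/eqP E|/mono]; last first.
  by move=> /(_ (esym ce)) /ltnW.
case/eqP: ne; apply/val_inj; move: E ce; rewrite /letter.
case: (val c) (val e) => [a b] [x y] /=.
by case: ltnP => ak; case: ltnP => xk E ax; congr (_, _); apply/val_inj => /=; lia.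
Qed.

Lemma syt_bij (T : {ffun cell la -> 'I_n}) : is_syt T -> bijective T.
Proof.
case/and3P => /injectiveP Tinj _ _.
by apply: inj_card_bij => //; rewrite card_cell card_ord.
Qed.

Hypothesis kl : 0 < k + l.

(** Every value is the entry of some cell when T is a standard tableau, so the
    default letter is never reached. *)
Definition word_of (T : {ffun cell la -> 'I_n}) : {ffun 'I_n -> 'I_(k + l)} :=
  [ffun i => if [pick c | T c == i] is Some c then insubd (Ordinal kl) (letter (val c)) else Ordinal kl].

Lemma word_ofE T c : is_syt T -> val (word_of T (T c)) = letter (val c).
Proof.
case/and3P => /injectiveP Tinj _ _; rewrite ffunE; case: pickP => [e /eqP/Tinj ->|/(_ c)].
  by rewrite val_insubd letter_hook.
by rewrite eqxx.
Qed.

(** Consider the least entry i that two tableaux with the same word put in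
    different cells.  Both cells lie in the same arm; in the tableau where i
    comes in the later cell, the earlier one already holds an entry below i,
    which both tableaux should place alike. *)
Lemma word_of_inj : {in @is_syt n la &, injective word_of}.
Proof.
move=> T U sT sU E.
have [T' TK T'K] := syt_bij T sT; have [U' UK U'K] := syt_bij U sU.
have lE i : letter (val (T' i)) = letter (val (U' i)).
  by rewrite -(word_ofE T _ sT) -(word_ofE U _ sU) E T'K U'K.
suff TU i : T' i = U' i by apply/ffunP => c; rewrite -[c in RHS]TK TU U'K.
have [m] := ubnP (val i); elim: m i => // m IH i im; apply/eqP/negP => /negP ne.
(* Which of the two cells comes first in the arm is read off in U. *)
have [lt|ge] := ltnP (U (T' i)) i.
  have := IH _ (leq_trans lt im); rewrite UK => /(canRL T'K) E1.
  by move: lt; rewrite -[X in _ < val X](T'K i) E1 T'K ltnn.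
have lt : T (U' i) < i.
  rewrite -[X in _ < val X](T'K i) (syt_mono T _ _ sT) ?lE // 1?eq_sym //.
  rewrite -(syt_mono U _ _ sU) ?lE // 1?eq_sym // U'K ltn_neqAle ge andbT.
  by apply/negP => /eqP/val_inj e; move/eqP: ne; apply; rewrite [in RHS]e UK.
have := IH _ (leq_trans lt im); rewrite TK => /(congr1 U); rewrite !U'K => E1.
by move: lt; rewrite -E1 ltnn.
Qed.

End UpperBound.

Variable R : realDomainType.

(** The words of the tableaux are among all words, whose total weight is the
    n-th power of the total weight of the letters. *)
Lemma num_syt_arm la (p : 'I_(k + l)) (x : R) : (la \in hook k l n)%SET -> (0 <= x)%R ->
  ((num_syt la)%:R * x ^+ arm la p <= ((k + l)%:R - 1 + x) ^+ n)%R.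
Proof.
move=> hla x0.
have kl : 0 < k + l by apply: leq_ltn_trans (ltn_ord p).
pose g (j : 'I_(k + l)) : R := if j == p then x else 1%R.
have -> : ((k + l)%:R - 1 + x = \sum_j g j)%R.
  rewrite (bigD1 p) //= /g eqxx addrC; congr (_ + _)%R.
  rewrite (eq_bigr (fun=> 1%R)) => [|j /negbTE -> //].
  rewrite sumr_const cardC1 card_ord.
  by rewrite -[in LHS](prednK kl) -natr1 addrK.
have g0 j : (0 <= g j)%R by rewrite /g; case: ifP.
have -> : ((\sum_j g j) ^+ n = \sum_(f : {ffun 'I_n -> 'I_(k + l)}) \prod_i g (f i))%R.
  by rewrite -(bigA_distr_bigA (fun=> g)) /= prodr_const card_ord.
have -> : ((num_syt la)%:R * x ^+ arm la p = \sum_(T in @is_syt n la) \prod_i g (word_of la kl T i))%R.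
  rewrite mulr_natl -sumr_const; apply: eq_bigr => T sT.
  rewrite (reindex T) /=; last by apply: onW_bij; apply: syt_bij.
  rewrite -prodr_const big_mkcond /=; apply: eq_bigr => c _.
  by rewrite inE /g -val_eqE /= word_ofE.
rewrite -(big_imset (h := word_of la kl) (fun f => \prod_i g (f i))%R) /=; last first.
  exact: word_of_inj.
rewrite big_mkcond /=; apply: ler_sum => f _.
by case: ifP => // _; apply: prodr_ge0.
Qed.
End Shapes.

(* C: walks *)
(** * Walks in the Weyl chamber *)

Section Walks.
Variables (R : realDomainType) (d : nat).
Implicit Types a b : nat -> nat.

Definition step a (i : nat) : nat -> nat := fun j => (a j + (j == i))%N.

Definition chamber a := [forall i : 'I_d, forall j : 'I_d, (i < j)%N ==> (a j < a i)%N].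

Definition vdm a : R := \prod_(i < d) \prod_(j < d | (i < j)%N) ((a i)%:R - (a j)%:R).

(** Negating the coordinates gives the Vandermonde determinant the sign that
    makes it positive on decreasing sequences. *)
Lemma vdmE a : vdm a = \det (Vandermonde d (\row_(j < d) (- (a j)%:R : R))).
Proof.
rewrite det_Vandermonde; apply: eq_bigr => i _; apply: eq_bigr => j _.
by rewrite !mxE opprK addrC.
Qed.

(** This is the derivative of det at A in the direction P A.  Expanding each
    determinant along the replaced column gives the trace of P A adj(A), where
    A adj(A) is scalar. *)
Lemma sum_det_replace_col (n : nat) (A P : 'M[R]_n) :
  \sum_(i < n) \det (\matrix_(r, c) if c == i then (P *m A) r c else A r c) = \tr P * \det A.
Proof.
transitivity (\sum_i \sum_r (P *m A) r i * cofactor A r i).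
  apply: eq_bigr => i _; rewrite (expand_det_col _ i); apply: eq_bigr => r _.
  rewrite mxE eqxx; congr (_ * _); rewrite /cofactor; congr (_ * \det _).
  by apply/matrixP => x y; rewrite !mxE eq_sym (negbTE (neq_lift _ _)).
rewrite exchange_big /=.
transitivity (\tr (P *m A *m \adj A)).
  by rewrite /mxtrace; apply: eq_bigr => r _; rewrite mxE; apply: eq_bigr => i _; rewrite [\adj A _ _]mxE.
by rewrite -mulmxA mul_mx_adj mul_mx_scalar mxtraceZ mulrC.
Qed.

(** Moving the i-th coordinate by one changes only the i-th column of the
    Vandermonde matrix, and by the binomial formula it multiplies this column
    by a matrix that does not depend on i.  That matrix is unipotent, so its
    trace is d. *)
Lemma vdm_harmonic a : \sum_(i < d) vdm (step a i) = d%:R * vdm a.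
Proof.
pose P : 'M[R]_d := \matrix_(r, m) ((-1) ^+ (r - m) *+ 'C(r, m)).
have trP : \tr P = d%:R.
  rewrite /mxtrace (eq_bigr (fun=> 1)) ?sumr_const ?card_ord //.
  by move=> i _; rewrite mxE subnn binn.
rewrite vdmE -trP -sum_det_replace_col; apply: eq_bigr => i _.
rewrite vdmE; congr (\det _); apply/matrixP => r c; rewrite !mxE /step.
rewrite (_ : (c == i :> nat) = (c == i)) //.
have [->|ci] := eqVneq c i; last by rewrite addn0.
rewrite natrD opprD addrC exprDn.
under [RHS]eq_bigr do rewrite !mxE mulrnAl.
rewrite (big_ord_widen d (fun m => (-1) ^+ (r - m) * (- (a i)%:R) ^+ m *+ 'C(r, m))) //.
rewrite big_mkcond; apply: eq_bigr => m _.
by case: ltnP => // rm; rewrite bin_small ?mulr0n.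
Qed.

Lemma chamberP a : reflect (forall i j, (i < j < d)%N -> (a j < a i)%N) (chamber a).
Proof.
apply: (iffP forallP) => [H i j /andP[ij jd]|H i].
  have /forallP/(_ (Ordinal jd)) := H (Ordinal (ltn_trans ij jd)).
  by rewrite /= ij.
by apply/forallP => j; apply/implyP => ij; apply: H; rewrite ij /=.
Qed.

(** A unit step that leaves the chamber makes two coordinates equal. *)
Lemma vdm_step_out a (i : 'I_d) : chamber a -> ~~ chamber (step a i) -> vdm (step a i) = 0.
Proof.
move=> /chamberP ca; rewrite negb_forall => /existsP[p]; rewrite negb_forall => /existsP[q].
rewrite negb_imply -leqNgt => /andP[pq].
have := ca p q; rewrite pq ltn_ord => /(_ isT) aqp le.
have E : step a i p = step a i q.
  by move: le aqp; rewrite /step; case: (_ == _); case: (_ == _) => /=; lia.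
by apply/eqP; rewrite prodf_seq_eq0; apply/hasP; exists p; rewrite ?mem_index_enum //=;
  rewrite prodf_seq_eq0; apply/hasP; exists q; rewrite ?mem_index_enum //= pq E subrr eqxx.
Qed.

Lemma vdm_bounds a m : chamber a -> (forall i, (i < d)%N -> (a i <= m)%N) ->
  1 <= vdm a <= m.+1%:R ^+ (d * d).
Proof.
move=> /chamberP ca am.
have F (i j : 'I_d) : (i < j)%N -> 1 <= ((a i)%:R - (a j)%:R : R) <= m.+1%:R.
  move=> ij; have := ca i j; rewrite ij ltn_ord => /(_ isT) aij.
  rewrite -natrB 1?ltnW // ler1n ler_nat subn_gt0 aij /=.
  by apply: leq_trans (leq_subr _ _) _; apply/leqW/am.
apply/andP; split.
  apply: (big_ind (fun x : R => 1 <= x)) => // [x y|i _]; first exact: mulr_ege1.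
  by apply: (big_ind (fun x : R => 1 <= x)) => // [x y|j /F /andP[]//]; exact: mulr_ege1.
have -> : m.+1%:R ^+ (d * d) = \prod_(i < d) \prod_(j < d) m.+1%:R :> R.
  by rewrite !prodr_const card_ord exprM.
rewrite /vdm; apply: ler_prod => i _.
rewrite big_mkcond /= prodr_ge0 => [|j _]; last first.
  by case: ifP => // /F /andP[/(le_trans ler01)].
apply: ler_prod => j _; case: ifP => [/F /andP[h1 ->]|_].
  by rewrite (le_trans ler01 h1).
by rewrite ler01 ler1n.
Qed.

Fixpoint walk a (s : seq nat) : bool :=
  if s is i :: s' then chamber (step a i) && walk (step a i) s' else true.

Definition arrive a (s : seq nat) : nat -> nat := fun j => (a j + count_mem j s)%N.

Lemma arrive_cons a i s : arrive a (i :: s) = arrive (step a i) s.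
Proof. by apply: funext => j; rewrite /arrive /step /= eq_sym addnA. Qed.

Lemma big_tupleS (V : nmodType) (T : finType) N (F : seq T -> V) :
  \sum_(t : N.+1.-tuple T) F t = \sum_x \sum_(t : N.-tuple T) F (x :: t).
Proof.
rewrite pair_big /= (reindex (fun p : T * N.-tuple T => [tuple of p.1 :: p.2])) //=.
exists (fun t => (thead t, [tuple of behead t])) => [[x t] _|t _] /=.
  by congr (_, _); apply/val_inj.
by rewrite [RHS]tuple_eta.
Qed.

(** Induction on N: by harmonicity the values at all neighbours add up to d
    times the value at a, and the neighbours outside of the chamber contribute
    nothing to that sum. *)
Lemma sum_walks a N : chamber a ->
  \sum_(t : N.-tuple 'I_d | walk a (map val t)) vdm (arrive a (map val t))
  = d%:R ^+ N * vdm a.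
Proof.
elim: N a => [|N IH] a ca; rewrite big_mkcond.
  rewrite (big_pred1 [tuple]) => [|t]; last by rewrite [t]tuple0; apply/esym/eqP.
  rewrite expr0 mul1r /=; congr vdm; apply: funext => j.
  by rewrite /arrive addn0.
rewrite (@big_tupleS _ _ _ (fun s => if walk a (map val s) then vdm (arrive a (map val s)) else 0)) /=.
transitivity (\sum_(x < d) d%:R ^+ N * vdm (step a x)); last first.
  by rewrite -mulr_sumr vdm_harmonic mulrA exprSr.
apply: eq_bigr => x _.
case: (boolP (chamber (step a x))) => [cx|nx] /=.
  rewrite -IH // [RHS]big_mkcond; apply: eq_bigr => t _.
  by rewrite arrive_cons.
by rewrite big1 // vdm_step_out // mulr0.
Qed.

Lemma walk_chamber a s : chamber a -> walk a s -> chamber (arrive a s).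
Proof.
elim: s a => [|i s IH] a ca /=; last by move=> /andP[ci /(IH _ ci)]; rewrite arrive_cons.
by move=> _; apply/chamberP => i j /(chamberP _ ca); rewrite /arrive !addn0.
Qed.

Lemma card_walks a N m : chamber a -> (forall i, (i < d)%N -> (a i + N <= m)%N) ->
  d%:R ^+ N <= #|[pred t : N.-tuple 'I_d | walk a (map val t)]|%:R * m.+1%:R ^+ (d * d) :> R.
Proof.
move=> ca am; apply: (@le_trans _ _ (d%:R ^+ N * vdm a)).
  have am0 i : (i < d)%N -> (a i <= m)%N.
    by move=> /am; apply: leq_trans (leq_addr _ _).
  by have /andP[? _] := vdm_bounds _ _ ca am0; rewrite ler_peMr ?exprn_ge0 ?ler0n.
rewrite -sum_walks // mulr_natl -sumr_const; apply: ler_sum => t wt.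
have atm i : (i < d)%N -> (arrive a (map val t) i <= m)%N.
  move=> /am; apply: leq_trans; rewrite /arrive leq_add2l.
  by apply: leq_trans (count_size _ _) _; rewrite size_map size_tuple.
by have /andP[] := vdm_bounds _ _ (walk_chamber _ _ ca wt) atm.
Qed.
End Walks.

(** * From words to tableaux *)

Section Positions.
Local Open Scope nat_scope.
Implicit Type w : seq nat.

(** The place of the r-th occurrence of j, counting from 0; it is handled only
    through the adjunction [ltn_pos] with prefix counts. *)
Definition pos w j r := find (fun m => r < count_mem j (take m.+1 w)) (iota 0 (size w)).

Lemma leq_count_take w j m m' : m <= m' -> count_mem j (take m w) <= count_mem j (take m' w).
Proof. by move=> /subnKC <-; rewrite takeD count_cat leq_addr. Qed.

Lemma ltn_pos w j r m : m <= size w -> (pos w j r < m) = (r < count_mem j (take m w)).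
Proof.
move=> mw; apply/idP/idP => [lt|].
  have hs : has (fun m => r < count_mem j (take m.+1 w)) (iota 0 (size w)).
    by rewrite has_find size_iota; apply: leq_trans lt mw.
  have := nth_find 0 hs; rewrite nth_iota ?add0n; last exact: leq_trans lt mw.
  by move=> /leq_trans; apply; apply: leq_count_take.
case: m mw => [|m] mw; first by rewrite take0.
apply: contraTT; rewrite -leqNgt => /(before_find 0).
by rewrite nth_iota // add0n => /negbT.
Qed.

Lemma pos_size w j r : r < count_mem j w -> pos w j r < size w.
Proof. by rewrite ltn_pos // take_size. Qed.

Lemma posP w j r : r < count_mem j w ->
  nth 0 w (pos w j r) = j /\ count_mem j (take (pos w j r) w) = r.
Proof.
move=> rj; have lt := pos_size _ _ _ rj.
have := ltn_pos w j r _ lt; rewrite ltnSn => /esym.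
have := ltn_pos w j r _ (ltnW lt); rewrite ltnn => /esym.
rewrite (take_nth 0 lt) -cats1 count_cat /= addn0.
by case: eqP => [->|_]; lia.
Qed.

Lemma ltn_pos_pos w i j r s : s < count_mem j w -> i != j ->
  r < count_mem i (take (pos w j s).+1 w) -> pos w i r < pos w j s.
Proof.
move=> sj ij; have lt := pos_size _ _ _ sj.
rewrite -ltn_pos // ltnS leq_eqVlt => /orP[/eqP E|//].
have ri : r < count_mem i w.
  by rewrite -[w in X in _ < X]take_size -ltn_pos // E.
by case/eqP: ij; rewrite -(posP _ _ _ ri).1 E (posP _ _ _ sj).1.
Qed.

Variables k l : nat.

(** These conditions ensure that the prefixes of w are the stages of a growing
    diagram.  The first one orders the rows among themselves and the columns
    among themselves; the second one makes the first k rows long enough to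
    support the columns before a cell is placed below them. *)
Definition admissible w := forall m i j, i < j < k + l ->
  count_mem j (take m w) <= count_mem i (take m w) /\
  (0 < count_mem j (take m w) -> l <= count_mem i (take m w)).

Variable n : nat.

(** The position of a cell in its arm, counting from 0. *)
Definition rank (c : 'I_n * 'I_n) : nat := if c.1 < k then c.2 : nat else c.1 - k.

Lemma letter_rank_inj (c e : 'I_n * 'I_n) :
  letter n k c = letter n k e -> rank c = rank e -> c = e.
Proof.
case: c e => [a b] [x y]; rewrite /letter /rank /=.
by do 2 case: ltnP => ?; move=> ? ?; congr (_, _); apply/val_inj => /=; lia.
Qed.

Variable la : intpart n.

(** Inclusion of the diagram in the arms drawn by w is enough: both have n
    cells. *)
Definition fits w := [/\ admissible w, size w = n &
  forall c, in_diagram la c -> letter n k c < k + l /\ rank c < count_mem (letter n k c) w].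

(** The r-th cell of an arm receives the place of the r-th occurrence of its
    letter.  The default value of insubd only has to exist, which the first
    coordinate of the cell provides. *)
Definition tableau w : {ffun cell la -> 'I_n} :=
  [ffun c => insubd (val c).1 (pos w (letter n k (val c)) (rank (val c)))].

Lemma tableauE w c : fits w -> val (tableau w c) = pos w (letter n k (val c)) (rank (val c)).
Proof.
by case=> _ sw /(_ _ (valP c))[_ /pos_size]; rewrite sw => lt; rewrite ffunE val_insubd lt.
Qed.

Lemma nth_tableau w c : fits w -> nth 0 w (tableau w c) = letter n k (val c).
Proof.
move=> fw; rewrite tableauE //; case: fw => _ _ /(_ _ (valP c))[_ /posP[]]//.
Qed.

Lemma tableau_inj w : fits w -> injective (tableau w).
Proof.
move=> fw c e E; have El : letter n k (val c) = letter n k (val e).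
  by rewrite -!(nth_tableau w) // E.
apply/val_inj/letter_rank_inj => //.
have := congr1 val E; rewrite !tableauE // El => Ep.
case: fw => _ _ dg; have [_ /posP[_ <-]] := dg _ (valP c).
by have [_ /posP[_ <-]] := dg _ (valP e); rewrite El Ep.
Qed.

(** Two cells of the same arm are compared by the order of the occurrences of
    a letter.  For cells of different arms, the occurrence of the larger letter
    forces, by admissibility, enough earlier occurrences of the smaller one. *)
Lemma tableau_syt w : fits w -> is_syt (tableau w).
Proof.
move=> fw; apply/and3P; split; first by apply/injectiveP/tableau_inj.
all: apply/forallP => c; apply/forallP => e; apply/implyP => /andP[/eqP E lt].
all: rewrite !tableauE //; case: (fw) => adm sw dg.
all: have [cd cr] := dg _ (valP c); have [ed er] := dg _ (valP e).
all: have es := pos_size _ _ _ er.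
all: have same : letter n k (val c) = letter n k (val e) -> rank (val c) < rank (val e) ->
      pos w (letter n k (val c)) (rank (val c)) < pos w (letter n k (val e)) (rank (val e))
   by move=> ->; rewrite (ltn_pos _ _ _ _ (ltnW es)) (posP _ _ _ er).2.
all: have diff : letter n k (val c) < letter n k (val e) ->
    (rank (val c) <= rank (val e)) || (rank (val c) < l) ->
      pos w (letter n k (val c)) (rank (val c)) < pos w (letter n k (val e)) (rank (val e)).
1,3: move=> lt' cond; apply: ltn_pos_pos => //; first (by rewrite ltn_eqF);
  have [h1 h2] := adm (pos w (letter n k (val e)) (rank (val e))).+1
     (letter n k (val c)) (letter n k (val e)) (introT andP (conj lt' ed));
  have := ltnSn (pos w (letter n k (val e)) (rank (val e))); rewrite ltn_pos // => h3;
  case/orP: cond => h4; [exact: leq_ltn_trans h4 (leq_trans h3 h1)|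
     exact: leq_trans h4 (h2 (leq_ltn_trans (leq0n _) h3))].
all: clear adm dg cr er es; move: E lt cd ed same diff; case: (val c) => [a b]; case: (val e) => [x y].
all: rewrite /letter /rank /=; move=> E lt; rewrite ?E.
- case: (ltnP x k) => xk; first by move=> _ _ same _; apply: same.
  by move=> _ _ _ diff; apply: diff; rewrite ?ltn_add2l ?leqnn.
- case: (ltnP x k) => xk; first have -> : a < k by apply: ltn_trans xk.
  by move=> _ _ _ diff; apply: diff; rewrite ?leqnn.
case: (ltnP a k) => ak cd ed same diff; [apply: diff; lia|apply: same; lia].
Qed.

Lemma card_le_num_syt (A : finType) (P : {pred A}) (W : A -> seq nat) :
  {in P &, injective W} -> {in P, forall x, fits (W x)} -> #|P| <= num_syt la.
Proof.
move=> Winj Wf; rewrite -(@fintype.card_in_image _ _ (fun x => tableau (W x))) => [|x y xP yP E].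
  by apply/subset_leq_card/fintype.subsetP => _ /fintype.imageP[x xP ->]; apply/tableau_syt/Wf.
have [fx fy] := (Wf _ xP, Wf _ yP); case: (fx) (fy) => _ sx _ [_ sy _].
apply: Winj => //; apply: (@eq_from_nth _ 0) => [|i]; first by rewrite sx.
rewrite sx => lt.
have [|g _ gK] := @inj_card_bij _ _ _ (tableau_inj _ fx).
  by rewrite card_cell card_ord.
by rewrite -[i]/(val (Ordinal lt)) -(gK (Ordinal lt)) nth_tableau // E nth_tableau.
Qed.
End Positions.

(** * The shape with prescribed arms *)

Section HookShape.
Local Open Scope nat_scope.

Lemma sum_ltn m N : \sum_(t < N) (t < m : nat) = minn m N.
Proof.
elim: N => [|N IH]; first by rewrite big_ord0 minn0.
by rewrite big_ord_recr /= IH; case: ltnP => ?; lia.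
Qed.

Variables (k l n : nat) (a : nat -> nat).
Hypothesis a_sum : \sum_(j < k + l) a j = n.
Hypothesis a_anti : forall i j, i < j < k + l -> a j <= a i.
Hypothesis a_rows : forall i, i < k -> 0 < a i /\ l <= a i.

Definition hook_row i := if i < k then a i else \sum_(q < l) (i - k < a (k + q)).

Lemma hook_row_anti i j : i <= j -> hook_row j <= hook_row i.
Proof.
rewrite leq_eqVlt => /orP[/eqP-> //|ij]; rewrite /hook_row.
case: (ltnP j k) => jk.
  by rewrite (ltn_trans ij jk) a_anti // ij ltn_addr.
case: (ltnP i k) => ik.
  apply: leq_trans (a_rows _ ik).2.
  rewrite -[leqRHS]card_ord -sum1_card; apply: leq_sum => q _; exact: leq_b1.
by apply: leq_sum => q _; case: (ltnP (j - k)) => //= /(leq_ltn_trans (leq_sub2r k (ltnW ij))) ->.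
Qed.

Lemma hook_row_ltn i x : k <= i -> x < hook_row i -> x < l /\ i - k < a (k + x).
Proof.
move=> ki; rewrite /hook_row (ltnNge i k) ki /= => lt.
have xl : x < l.
  apply: leq_trans lt _; rewrite -[leqRHS]card_ord -sum1_card.
  by apply: leq_sum => q _; exact: leq_b1.
split=> //; rewrite ltnNge; apply: contraL lt => ax; rewrite -leqNgt.
apply: leq_trans (geq_minl x l); rewrite -sum_ltn; apply: leq_sum => q _.
case: (ltnP q x) => [_|xq]; first exact: leq_b1.
rewrite leqn0 eqb0 -leqNgt; apply: leq_trans ax.
case: ltngtP xq => // [xq _|-> _ //]; apply: a_anti.
by rewrite !ltn_add2l xq ltn_ord.
Qed.

Lemma sum_hook_row : \sum_(i < n) hook_row i = n.
Proof.
have kn : k <= n.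
  rewrite -[X in _ <= X]a_sum big_split_ord /=; apply: leq_trans (leq_addr _ _).
  rewrite -[X in X <= _]card_ord -sum1_card; apply: leq_sum => i _.
  by case: (a_rows i).
have an q : q < l -> a (k + q) <= n - k.
  move=> ql; rewrite leq_subRL // -[X in _ <= X]a_sum big_split_ord /=.
  apply: leq_add.
    rewrite -[X in X <= _]card_ord -sum1_card; apply: leq_sum => i _.
    by case: (a_rows i).
  by rewrite (bigD1 (Ordinal ql)) //= leq_addr.
rewrite -(big_mkord xpredT) (@big_cat_nat _ _ _ k) //= -[RHS]a_sum big_split_ord /=.
rewrite -[in X in _ = _ + X](big_mkord xpredT (fun q => a (k + q))).
congr (_ + _); first by rewrite big_mkord; apply: eq_bigr => i _; rewrite /hook_row ltn_ord.
rewrite -[X in \sum_(X <= _ < _) _]add0n big_addn big_mkord.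
transitivity (\sum_(t < n - k) \sum_(q < l) (t < a (k + q))).
  by apply: eq_bigr => t _; rewrite /hook_row ltnNge leq_addl /= addnK.
rewrite exchange_big big_mkord; apply: eq_bigr => q _.
by rewrite sum_ltn; apply/minn_idPl/an.
Qed.

Lemma hook_row_leq i : i < n -> hook_row i <= n.
Proof.
by move=> lt; rewrite -[X in _ <= X]sum_hook_row (bigD1 (Ordinal lt)) //= leq_addr.
Qed.

(** The rows below the k-th one are the rows of the conjugate of the partition
    formed by the last l arms. *)
Lemma exists_hook_shape : exists2 la : intpart n, (la \in hook k l n)%SET &
  forall c, in_diagram la c -> letter n k c < k + l /\ rank k n c < a (letter n k c).
Proof.
pose t : n.-tuple 'I_n.+1 := [tuple inord (hook_row i) | i < n].
have tE : map val t = mkseq hook_row n.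
  apply: (@eq_from_nth _ 0) => [|i]; first by rewrite size_map size_mkseq size_tuple.
  rewrite size_map size_tuple => lt; rewrite (nth_map ord0) ?size_tuple // nth_mkseq //.
  rewrite -[i]/(val (Ordinal lt)) -tnth_nth tnth_mktuple /= inordK //.
  by rewrite ltnS hook_row_leq.
have tP : is_intpart t.
  rewrite /is_intpart tE; apply/andP; split.
    apply: (@homo_sorted _ _ _ leq) (iota_sorted 0 n) => i j; exact: hook_row_anti.
  by rewrite sumnE big_map -[X in _ == X]sum_hook_row -(big_mkord xpredT) /index_iota subn0.
pose la : intpart n := Sub t tP.
have rE i : i < n -> row_len la i.+1 = hook_row i.
  by move=> lt; rewrite /row_len /= tE nth_mkseq.
exists la => [|[i x]].
  rewrite inE; case: (ltnP k n) => kn; last by rewrite /row_len nth_default // tE size_mkseq.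
  rewrite rE // /hook_row ltnn -[leqRHS]card_ord -sum1_card.
  by apply: leq_sum => q _; exact: leq_b1.
rewrite /in_diagram /letter /rank /= rE //.
case: (ltnP i k) => ik; first by rewrite /hook_row ik ltn_addr.
by move=> /(hook_row_ltn _ _ ik)[xl ->]; rewrite ltn_add2l.
Qed.
End HookShape.

(** * A shape with many tableaux *)

Section LowerBound.
Local Open Scope nat_scope.
Implicit Types u v w : seq nat.

Lemma sum_count_mem d w : all (fun x => x < d) w -> \sum_(j < d) count_mem (val j) w = size w.
Proof.
elim: w => [_|x w IH /= /andP[xd /IH <-]]; first by rewrite big1.
rewrite big_split /= (bigD1 (Ordinal xd)) //= eqxx big1 ?addn0 // => j.
by rewrite -val_eqE /= eq_sym => /negbTE ->.
Qed.

Variables k l : nat.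

Lemma admissible_cat u v : admissible k l u ->
  (forall m i j, i < j < k + l ->
     count_mem j (u ++ take m v) <= count_mem i (u ++ take m v) /\
     (0 < count_mem j (u ++ take m v) -> l <= count_mem i (u ++ take m v))) ->
  admissible k l (u ++ v).
Proof.
move=> adu H m i j ij; rewrite take_cat; case: ltnP => _; first exact: adu.
exact: H.
Qed.

(** A starting point for the walks: strictly decreasing, as the chamber
    requires, with all entries at least l, so that the second condition of
    admissibility holds from there on. *)
Definition start_content j := k + l - j + l.

(** Fill the arms one after the other. *)
Lemma exists_start : exists u, [/\ admissible k l u, all (fun x => x < k + l) u &
  forall j, j < k + l -> count_mem j u = start_content j].
Proof.
suff H r : r <= k + l -> exists u, [/\ admissible k l u, all (fun x => x < k + l) u &
    forall j, count_mem j u = if j < r then start_content j else 0].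
  have [u [? ? cu]] := H _ (leqnn _); exists u; split=> // j jd.
  by rewrite cu jd.
elim: r => [_|r IH rd]; first by exists [::].
have [u [adu au cu]] := IH (ltnW rd).
exists (u ++ nseq (start_content r) r); split.
- apply: admissible_cat => // m i j ij.
  have -> : take m (nseq (start_content r) r) = nseq (minn m (start_content r)) r.
    case: (leqP m (start_content r)) => mb; last by rewrite take_oversize // size_nseq ltnW.
    by rewrite take_nseq.
  rewrite !count_cat !count_nseq !cu /=.
  have : minn m (start_content r) <= start_content r by apply: geq_minr.
  move: (minn _ _) => c; rewrite /start_content.
  by case: (ltnP i r); case: (ltnP j r); case: (eqVneq r i); case: (eqVneq r j) => /=; lia.
- by rewrite all_cat au /= all_nseq rd orbT.
move=> j; rewrite count_cat count_nseq cu /= ltnS.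
by case: (ltngtP j r) => [||->] /=; rewrite ?mul1n ?mul0n ?addn0.
Qed.

(** Each walk from the starting point, preceded by a fixed word that leads
    there, is an admissible word.  Words with the same letter counts give
    distinct tableaux of one shape, and there are at most (n + 1) ^ (k + l)
    possible counts. *)
Lemma num_syt_lower (R : realDomainType) : 0 < k + l -> exists N, forall n, N <= n ->
  ((k + l)%:R ^+ (n - N) <= (\max_(la in hook k l n) num_syt la)%:R *
    n.+1%:R ^+ (k + l + (k + l) * (k + l)) :> R)%R.
Proof.
move=> kl0; have [u [adu au cu]] := exists_start.
set d := k + l in kl0 au cu *.
exists (size u) => n un; set M := \max_(la in _) _.
pose N := n - size u.
pose P := [pred t : N.-tuple 'I_d | walk d start_content (map val t)].
pose W (t : N.-tuple 'I_d) := u ++ map val t.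
have bu i : i < d -> start_content i + N <= n.
  by move=> /cu <-; rewrite /N -leq_subRL ?leq_sub2l // ?count_size // (leq_trans (count_size _ _)).
have chb : chamber d start_content by apply/chamberP => i j; rewrite /start_content; lia.
have cW t j m : j < d -> count_mem j (u ++ take m (map val t)) = arrive start_content (take m (map val t)) j.
  by move=> jd; rewrite count_cat cu.
have admW t : t \in P -> admissible k l (W t).
  move=> Pt; apply: admissible_cat => // m i j /andP[ij jd].
  have /chamberP ch : chamber d (arrive start_content (take m (map val t))).
    apply: walk_chamber => //; move: Pt; rewrite inE.
    elim: (map val t) m start_content {chb bu cu cW} => [|x s IH] [|m] b //= /andP[-> /=]; exact: IH.
  rewrite !cW ?(ltn_trans ij jd) //; split; first by rewrite ltnW // ch // ij.
  by move=> _; rewrite /arrive /start_content -addnA; lia.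
have sW t : size (W t) = n by rewrite size_cat size_map size_tuple subnKC.
have aW t : all (fun x => x < d) (W t).
  by rewrite all_cat au /=; apply/allP => _ /mapP[x _ ->].
have Winj : injective W.
  move=> s t /eqP; rewrite eqseq_cat // eqxx /= => /eqP/(inj_map val_inj) E.
  exact: val_inj.
have cardP : #|P| <= M * n.+1 ^ d.
  pose phi (t : N.-tuple 'I_d) : {ffun 'I_d -> 'I_n.+1} := [ffun j => inord (count_mem (val j) (W t))].
  have phiP s t : phi s = phi t -> forall j, j < d -> count_mem j (W s) = count_mem j (W t).
    move=> /ffunP E j jd; have := congr1 val (E (Ordinal jd)); rewrite !ffunE /=.
    have bW r : count_mem j (W r) < n.+1 by rewrite ltnS -[X in _ <= X](sW r) count_size.
    by rewrite !inordK.
  rewrite -sum1_card (partition_big phi xpredT) //=.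
  have -> : M * n.+1 ^ d = \sum_(f : {ffun 'I_d -> 'I_n.+1}) M.
    by rewrite sum_nat_const card_ffun !card_ord mulnC.
  apply: leq_sum => f _; rewrite sum1_card.
  have [t0 /andP[Pt0 /eqP ft0]|none] := pickP [pred t in P | phi t == f]; last by rewrite eq_card0.
  have sumW t : \sum_(j < d) count_mem (val j) (W t) = n by rewrite sum_count_mem.
  have anti i j : i < j < k + l -> count_mem j (W t0) <= count_mem i (W t0).
    by move=> ij; have := admW _ Pt0 n i j ij; rewrite -(sW t0) take_size => -[].
  have rows i : i < k -> 0 < count_mem i (W t0) /\ l <= count_mem i (W t0).
    by move=> ik; rewrite count_cat cu ?ltn_addr // /start_content; lia.
  have [la lah lac] := exists_hook_shape _ _ _ _ (sumW t0) anti rows.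
  apply: leq_trans (leq_bigmax_cond _ lah).
  apply: (card_le_num_syt k l n la _ _ W) => [s t _ _|t /andP[Pt /eqP ft]]; first exact: Winj.
  split; [exact: admW | exact: sW | move=> c /lac[cd cr]].
  by split=> //; rewrite (phiP t t0) // ft ft0.
apply: le_trans (card_walks R d start_content N n chb bu) _.
rewrite exprD mulrA ler_wpM2r ?exprn_ge0 ?ler0n //.
by rewrite -natrX -natrM ler_nat.
Qed.
End LowerBound.

(** * The mean length of an arm *)

(** Jensen's inequality for exp, by comparison with the tangent at the mean. *)
Lemma expR_mean (R : realType) (I : finType) (A : {pred I}) (w y : I -> R) :
  (forall i, 0 <= w i) -> 0 < \sum_(i in A) w i ->
  (\sum_(i in A) w i) * expR ((\sum_(i in A) w i * y i) / \sum_(i in A) w i)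
  <= \sum_(i in A) w i * expR (y i).
Proof.
move=> w0 Z0; set Z := \sum_(i in A) w i in Z0 *; set m := _ / Z.
have E : \sum_(i in A) w i * (1 + (y i - m)) = Z.
  under eq_bigr do rewrite mulrDr mulr1 mulrBr.
  rewrite big_split /= sumrB -mulr_suml -/Z /m mulrCA divff ?gt_eqF // mulr1 subrr addr0 //.
rewrite -[X in X * _]E mulr_suml; apply: ler_sum => i _.
rewrite -mulrA ler_wpM2l //.
by rewrite -[y i in leRHS](subrK m) expRD ler_wpM2r ?expR_ge0 // expR_ge1Dx.
Qed.

(** The inequality 1 - s <= exp (- s) bounds exp s by 1 / (1 - s), which is at
    most 1 + s + 2 s ^ 2 for s <= 1/2. *)
Lemma expR_le_quad (R : realType) (s : R) : s <= 2^-1 -> expR s <= 1 + (s + 2 * s ^+ 2).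
Proof.
move=> s2; have h : 0 < 1 - s by lra.
have e : expR s * (1 - s) <= 1.
  apply: (@le_trans _ _ (expR s * expR (- s))); last by rewrite -expRD subrr expR0.
  by rewrite ler_wpM2l ?expR_ge0 // expR_ge1Dx.
rewrite -(ler_pM2r h); apply: le_trans e _.
have : 0 <= s ^+ 2 * (1 - 2 * s) by rewrite mulr_ge0 ?sqr_ge0 //; lra.
nra.
Qed.

Section Expectation.
Variables (R : realType) (beta : R) (k l : nat).
Hypothesis beta_gt0 : 0 < beta.

Definition mean n (X : intpart n -> R) : R :=
  (\sum_(la in hook k l n) X la * (num_syt la)%:R `^ beta) /
  (\sum_(la in hook k l n) (num_syt la)%:R `^ beta).

Lemma sum_tilted n (p : 'I_(k + l)) (s : R) :
  \sum_(la in hook k l n) (num_syt la)%:R `^ beta * expR (s * beta * (arm n k la p)%:R)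
  <= n.+1%:R ^+ (k + l) * (((k + l)%:R - 1 + expR s) ^+ n) `^ beta.
Proof.
set q := _ - 1 + _.
apply: (@le_trans _ _ (\sum_(la in hook k l n) (q ^+ n) `^ beta)).
  apply: ler_sum => la hla.
  have -> : s * beta * (arm n k la p)%:R = (arm n k la p)%:R * s * beta by ring.
  rewrite expRM expRM_natl -powRM ?ler0n ?exprn_ge0 ?expR_ge0 //.
  apply: ge0_ler_powR; first exact: ltW.
  - by rewrite nnegrE mulr_ge0 ?exprn_ge0 ?expR_ge0.
  - rewrite nnegrE exprn_ge0 // addr_ge0 ?expR_ge0 // subr_ge0 ler1n.
    exact: leq_ltn_trans (ltn_ord p).
  - by apply: num_syt_arm => //; exact: expR_ge0.
rewrite sumr_const -[leLHS]mulr_natl ler_wpM2r ?powR_ge0 //.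
by rewrite -natrX ler_nat card_hook.
Qed.

Lemma sum_powR_ge n : let M := (\max_(la in hook k l n) num_syt la)%N in
  (0 < M)%N -> 0 < M%:R `^ beta <= \sum_(la in hook k l n) (num_syt la)%:R `^ beta.
Proof.
move=> M M0; rewrite powR_gt0 ?ltr0n //=.
have [|la hla ME] := @eq_bigmax_cond _ [in hook k l n] (@num_syt n).
  case: (pickP [in hook k l n]) => [la hla|none]; first by apply/card_gt0P; exists la.
  by move: M0; rewrite /M big_pred0.
by rewrite /M ME (bigD1 la) //= lerDl sumr_ge0 // => ? _; exact: powR_ge0.
Qed.

Lemma ln_le_sub1 (x : R) : 0 < x -> ln x <= x - 1.
Proof.
move=> x0; rewrite lerBrDl -[leRHS]lnK ?posrE //; exact: expR_ge1Dx.
Qed.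

(** Combine, on a logarithmic scale, Jensen's inequality for s beta a_p, the
    bound on the exponential moment and the lower bound on the total weight.
    The leading terms n ln d cancel. *)
Lemma mean_tilt (p : 'I_(k + l)) : exists B : R, exists C : R,
  [/\ 0 <= B & \forall n \near \oo,
   forall s, s <= 2^-1 ->
   s * mean n (fun la => (arm n k la p)%:R)
     <= n%:R * ((s + 2 * s ^+ 2) / (k + l)%:R) + B * ln n.+1%:R + C].
Proof.
have kl : (0 < k + l)%N by apply: leq_ltn_trans (ltn_ord p).
have [N low] := num_syt_lower k l R kl.
set d : R := (k + l)%:R; have d0 : 0 < d by rewrite ltr0n.
set K := (k + l + _)%N in low.
exists (d / beta + K%:R), (N%:R * ln d); split.
  by rewrite addr_ge0 ?ler0n // divr_ge0 // ltW.
near=> n => s s2.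
have Nn : (N <= n)%N by near: n; exact: nbhs_infty_ge.
have {low} := low n Nn; rewrite -/d; set M := (\max_(la in _) _)%N => low.
have n0 : 0 < n.+1%:R :> R by rewrite ltr0n.
have M0 : (0 < M)%N.
  rewrite lt0n; apply/eqP => M0; move: low; rewrite M0 mul0r leNgt.
  by rewrite exprn_gt0.
have /andP[MB MZ] := sum_powR_ge n M0; rewrite -/M in MB MZ.
have MR : 0 < M%:R :> R by rewrite ltr0n.
set L := ln n.+1%:R.
have {}low : (n%:R - N%:R) * ln d <= ln M%:R + K%:R * L.
  have : ln (d ^+ (n - N)) <= ln (M%:R * n.+1%:R ^+ K).
    by rewrite ler_ln ?posrE ?exprn_gt0 // mulr_gt0 // exprn_gt0.
  rewrite lnM ?posrE ?exprn_gt0 // !lnXn // -natrB // -/L.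
  by rewrite -!(mulr_natl (ln _)).
set q := d - 1 + expR s.
have q0 : 0 < q.
  by rewrite ltr_wpDl ?expR_gt0 // subr_ge0 ler1n.
have lnq : ln q <= ln d + (s + 2 * s ^+ 2) / d.
  have -> : q = d * (q / d) by rewrite mulrC divfK ?gt_eqF.
  rewrite lnM ?posrE ?divr_gt0 // lerD2l.
  apply: le_trans (ln_le_sub1 _ _) _; first by rewrite divr_gt0.
  have -> : q / d - 1 = (expR s - 1) / d.
    by apply: (mulIf (lt0r_neq0 d0)); rewrite mulrBl !divfK ?lt0r_neq0 // /q; ring.
  rewrite ler_pM2r ?invr_gt0 //; have := expR_le_quad _ _ s2; lra.
set Z := \sum_(la in hook k l n) (num_syt la)%:R `^ beta in MZ.
set m := mean n _.
have tilt : M%:R `^ beta * expR (s * beta * m) <= n.+1%:R ^+ (k + l) * (q ^+ n) `^ beta.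
  apply: le_trans (sum_tilted n p s); apply: le_trans (ler_wpM2r (expR_ge0 _) MZ) _.
  have := @expR_mean _ _ [in hook k l n] (fun la => (num_syt la)%:R `^ beta)
     (fun la => s * beta * (arm n k la p)%:R) (fun _ => powR_ge0 _ _) (lt_le_trans MB MZ).
  apply: le_trans; rewrite -/Z ler_wpM2l ?(ltW (lt_le_trans MB MZ)) //.
  rewrite ler_expR /m /mean -/Z mulrA mulr_sumr le_eqVlt; apply/orP; left; apply/eqP.
  by congr (_ / _); apply: eq_bigr => la _; ring.
have {tilt} : beta * ln M%:R + s * beta * m <= (k + l)%:R * L + beta * (n%:R * ln q).
  have : ln (M%:R `^ beta * expR (s * beta * m)) <= ln (n.+1%:R ^+ (k + l) * (q ^+ n) `^ beta).
    by rewrite ler_ln ?posrE ?mulr_gt0 ?expR_gt0 ?powR_gt0 ?exprn_gt0.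
  rewrite !lnM ?posrE ?expR_gt0 ?powR_gt0 ?exprn_gt0 // expRK !ln_powR !lnXn // -/L.
  by rewrite -!(mulr_natl (ln _)).
rewrite -/d => tilt.
rewrite -(ler_pM2l beta_gt0).
have h1 := ler_wpM2l (ltW beta_gt0) low.
have h2 := ler_wpM2l (mulr_ge0 (ltW beta_gt0) (ler0n R n)) lnq.
have -> : beta * (n%:R * ((s + 2 * s ^+ 2) / d) + (d / beta + K%:R) * L + N%:R * ln d)
  = beta * n%:R * ((s + 2 * s ^+ 2) / d) + d * L + beta * K%:R * L + beta * N%:R * ln d.
  have bd : beta * (d / beta) = d by rewrite mulrC divfK ?lt0r_neq0.
  by rewrite -[X in _ = _ + X * L + _ + _]bd; ring.
nra.
Unshelve. all: by end_near.
Qed.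

End Expectation.

Section Limit.
Variables (R : realType) (beta : R) (k l : nat).
Hypothesis beta_gt0 : 0 < beta.

Lemma mean_dist n (X Y : intpart n -> R) (c : R) : 0 <= c ->
  (forall la, `|X la - Y la| <= c) -> `|mean R beta k l n X - mean R beta k l n Y| <= c.
Proof.
move=> c0 XY; rewrite /mean -mulrBl -sumrB.
set Z := \sum_(la in _) _ `^ _.
have Z0 : 0 <= Z by apply: sumr_ge0 => la _; exact: powR_ge0.
have [->|Zn0] := eqVneq Z 0; first by rewrite invr0 mulr0 normr0.
have {Zn0}Z0 : 0 < Z by rewrite lt_neqAle eq_sym Zn0.
have Zi : 0 <= Z^-1 by rewrite invr_ge0 ltW.
rewrite normrM (ger0_norm Zi) ler_pdivrMr // /Z mulr_sumr.
apply: le_trans (ler_norm_sum _ _ _) _; apply: ler_sum => la _.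
by rewrite -mulrBl normrM [X in _ * X]ger0_norm ?powR_ge0 // ler_wpM2r ?powR_ge0.
Qed.

(** The logarithm lies below lines of arbitrarily small slope; this is how
    ln n is made negligible with respect to n. *)
Lemma ln_le_line (eta x : R) : 0 < eta -> 0 < x -> ln x <= eta * x - (1 + ln eta).
Proof.
move=> e0 x0; have := ln_le_sub1 _ (eta * x) (mulr_gt0 e0 x0).
by rewrite lnM ?posrE //; lra.
Qed.

(** Divided by the step h, the inequality of [mean_tilt] at h and - h leaves an
    error of at most 2 h n / d + O(ln n) / h. *)
Lemma mean_limit (p : 'I_(k + l)) (X : forall n, intpart n -> R) :
  (forall n la, `|X n la - (arm n k la p)%:R| <= k%:R) ->
  mean R beta k l n (X n) / (n%:R / (k + l)%:R) @[n --> \oo] --> (1 : R).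
Proof.
move=> Xarm; have [B [C [B0 tilt]]] := mean_tilt R beta k l beta_gt0 p.
set d : R := (k + l)%:R in tilt *.
have d0 : 0 < d by rewrite ltr0n; apply: leq_ltn_trans (ltn_ord p).
apply/cvgrPdist_le => e e0.
(* The error splits into three parts, each at most (e / 4) n / d: the quadratic
   term in h, the slope eta of the line above the logarithm, and constants. *)
pose h := Num.min (e / 8) (2^-1).
have h0 : 0 < h by rewrite lt_min; apply/andP; split; lra.
have he : h <= e / 8 by rewrite ge_min lexx.
have h2 : h <= 2^-1 by rewrite ge_min lexx orbT.
pose eta := h * (e / 4) / (d * (B + 1)).
have B1 : 0 < B + 1 by rewrite ltr_wpDl.
have e4 : 0 < e / 4 by rewrite divr_gt0.
have he4 : 0 < h * (e / 4) by rewrite mulr_gt0.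
have eta0 : 0 < eta by rewrite divr_gt0 // mulr_gt0.
have Beta : B * eta <= h * (e / 4) / d.
  have -> : B * eta = B / (B + 1) * (h * (e / 4) / d) by rewrite /eta invfM; ring.
  apply: ler_piMl; first by rewrite ltW // divr_gt0.
  by rewrite ler_pdivrMr // mul1r lerDl.
pose C' := B * eta - B * (1 + ln eta) + C + h * k%:R.
near=> n.
have n0 : 0 < n%:R :> R by rewrite ltr0n; near: n; exact: nbhs_infty_gt.
have nC : C' * (d / (h * (e / 4))) <= n%:R by near: n; exact: nbhs_infty_ger.
have tiltn : forall s, s <= 2^-1 -> s * mean R beta k l n (fun la => (arm n k la p)%:R)
     <= n%:R * ((s + 2 * s ^+ 2) / d) + B * ln n.+1%:R + C by near: n.
set E := mean _ _ _ _ _ _ in tiltn; set m := mean _ _ _ _ _ _.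
have /ler_normlP[mE Em] : `|m - E| <= k%:R by apply: mean_dist => // la; exact: Xarm.
have nd0 : 0 < n%:R / d by rewrite divr_gt0.
rewrite -[X in `|X - _|](divff (lt0r_neq0 nd0)) -mulrBl normrM.
have ndi : 0 <= (n%:R / d)^-1 by rewrite invr_ge0 ltW.
rewrite (ger0_norm ndi) ler_pdivrMr // -(ler_pM2l h0).
rewrite -[h in leLHS](ger0_norm (ltW h0)) -normrM.
have up := tiltn h h2.
have lo := tiltn (- h) (ltac:(lra)).
have BL : B * ln n.+1%:R <= h * (e / 4) / d * n%:R + (B * eta - B * (1 + ln eta)).
  have := ler_wpM2l B0 (ln_le_line _ _ eta0 (ltr0Sn R n)).
  have := ler_wpM2r (ltW n0) Beta.
  rewrite -[n.+1]addn1 natrD; nra.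
have big : C' <= h * (e / 4) * (n%:R / d).
  move: nC; rewrite -ler_pdivlMr ?divr_gt0 // invf_div.
  by rewrite mulrCA mulrC mulrA.
rewrite /C' in big.
have hh : 2 * h ^+ 2 * (n%:R / d) <= h * (e / 4) * (n%:R / d).
  by rewrite ler_pM2r // expr2 mulrCA ler_pM2l //; lra.
set r := n%:R / d in nd0 big hh *.
have E1 s : n%:R * ((s + 2 * s ^+ 2) / d) = (s + 2 * s ^+ 2) * r.
  by rewrite /r; ring.
have E2 : h * (e / 4) / d * n%:R = h * (e / 4) * r by rewrite /r; ring.
rewrite !E1 in up lo; rewrite E2 in BL.
have hEm := ler_wpM2l (ltW h0) Em; have hmE := ler_wpM2l (ltW h0) mE.
have her : 0 < h * (e / 4) * r by rewrite mulr_gt0.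
by apply/ler_normlP; split; lra.
Unshelve. all: by end_near.
Qed.
End Limit.

Theorem theorem4p1 (R : realType) (k l : nat) (beta : R)
    (kl_gt0 : (1 <= k + l)%N) (beta_gt0 : 0 < beta) :
  (forall p : nat, (1 <= p <= k)%N ->
     expected_row beta k l p n / (n%:R / (k + l)%:R) @[n --> \oo] --> (1 : R)) /\
  (forall q : nat, (1 <= q <= l)%N ->
     expected_col beta k l q n / (n%:R / (k + l)%:R) @[n --> \oo] --> (1 : R)).
Proof.
split=> [[//|p] /= pk|[//|q] /= ql].
  pose j := Ordinal (ltn_addr l pk : (p < k + l)%N).
  apply: (mean_limit R beta k l beta_gt0 j (fun n la => (row_len la p.+1)%:R)) => n la.
  by rewrite arm_row // subrr normr0.
have jP : (k + q < k + l)%N by rewrite ltn_add2l.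
apply: (mean_limit R beta k l beta_gt0 (Ordinal jP) (fun n la => (col_len la q.+1)%:R)) => n la.
have /andP[lo up] := arm_col n k la q.
by rewrite -natrB // ger0_norm // ler_nat /=; lia.
Qed.
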